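(* Let $N,m,r$ be positive integers, let $\Phi\in\mathbb{R}^{N\times m}$ have orthonormal columns, let $C\in\mathbb{R}^{r\times N}$ be a selection matrix, and let $\mathbf{y}=C\mathbf{u}\in\mathbb{R}^r$, where $\mathbf{u}\in\mathbb{R}^N$ satisfies $u_{\min}\le u_i\le u_{\max}$ for all $i$. Let $p:\mathbb{R}\to\mathbb{R}$ be an admissible penalty function for the interval $[u_{\min},u_{\max}]$, and let $\mathcal{P}(\alpha)=\sum_{i=1}^N p([\Phi\alpha]_i)$ be the associated total penalty. Assume that the constraint set $$\mathcal{S}=\{\alpha\in\mathbb{R}^m : u_{\min}\le[\Phi\alpha]_i\le u_{\max},\ i=1,\dots,N\}$$ is nonempty. For each $\lambda>0$ let $\alpha(\lambda)\in\mathbb{R}^m$ be a minimizer over $\mathbb{R}^m$ of $$f_\lambda(\alpha)=\tfrac12|C\Phi\alpha-\mathbf{y}|^2+\lambda\,\mathcal{P}(\alpha).$$ Then $$\lim_{\lambda\to\infty}\mathrm{d}(\alpha(\lambda),\mathcal{S})=0,$$ where $\mathrm{d}(\alpha,\mathcal{S})=\inf_{\beta\in\mathcal{S}}|\alpha-\beta|$ is the Euclidean distance from the point $\alpha$ to the set $\mathcal{S}$.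
   Context: $|\cdot|$ is the Euclidean norm and $[\Phi\alpha]_i$ is the $i$-th coordinate of $\Phi\alpha$. The bounds $u_{\min}\le u_{\max}$ are real numbers. A selection matrix $C\in\mathbb{R}^{r\times N}$ is a matrix whose rows are $r$ distinct rows of the $N\times N$ identity matrix. A function $p:\mathbb{R}\to\mathbb{R}$ is an admissible penalty function for $[u_{\min},u_{\max}]$ if: (1) $p$ is nonnegative, convex, twice continuously differentiable, $p''$ is Lipschitz continuous, and $p''(u)>0$ for all $u\notin[u_{\min},u_{\max}]$; (2) $p(u)=0$ for all $u\in[u_{\min},u_{\max}]$; (3) $p$ is monotonically decreasing for $u<u_{\min}$ and monotonically increasing for $u>u_{\max}$. *)

(* Defs.v *)
From mathcomp Require Export all_boot all_order all_algebra.
From mathcomp Require Export all_classical all_reals all_analysis.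

Set Implicit Arguments.
Unset Strict Implicit.
Unset Printing Implicit Defensive.

Import Order.TTheory GRing.Theory Num.Theory.
Import numFieldNormedType.Exports.

Local Open Scope classical_set_scope.
Local Open Scope ring_scope.

(* Points of R^n are the column vectors ['cV[R]_n].
   The library's norm [`|v|] on matrices is the max norm, hence this definition. *)
Definition enorm (R : realType) (n : nat) (v : 'cV[R]_n) : R :=
  Num.sqrt (\sum_(i < n) v i ord0 ^+ 2).

(* [inf set0 = 0] in the library: only meaningful for [S !=set0]. *)
Definition edist_set (R : realType) (n : nat) (a : 'cV[R]_n)
    (S : set 'cV[R]_n) : R :=
  inf [set enorm (a - b) | b in S].

Definition orthonormal_columns (R : realType) (N m : nat)
    (Phi : 'M[R]_(N, m)) : Prop :=
  forall j k : 'I_m, \sum_(i < N) Phi i j * Phi i k = (j == k)%:R.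

Definition selection_matrix (R : realType) (r N : nat)
    (C : 'M[R]_(r, N)) : Prop :=
  exists2 s : 'I_r -> 'I_N,
    injective s & forall i : 'I_r, row i C = row (s i) (1%:M : 'M[R]_N).

(* [derive1] is total, so [p] being C^2 needs the derivability of [p] and [p']
   besides the continuity of [p'']. Monotonicity is non-strict. *)
Record admissible_penalty (R : realType) (umin umax : R) (p : R -> R) : Prop :=
  AdmissiblePenalty {
    penalty_ge0 : forall u : R, 0 <= p u;
    penalty_convex : convex_function (setT : set R^o) p;
    penalty_derivable : forall u : R, derivable p u 1;
    penalty_derivable2 : forall u : R, derivable (p^`())%classic u 1;
    penalty_continuous2 : continuous (p^`(2))%classic;
    penalty_lipschitz2 : lipschitz (p^`(2))%classic;
    penalty_gt0_2 : forall u : R, u \notin `[umin, umax] -> 0 < (p^`(2))%classic u;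
    penalty_eq0 : forall u : R, u \in `[umin, umax] -> p u = 0;
    penalty_decr : {in `]-oo, umin[ &, {homo p : x y /~ x <= y}};
    penalty_incr : {in `]umax, +oo[ &, {homo p : x y / x <= y}}
  }.

Definition total_penalty (R : realType) (N m : nat) (Phi : 'M[R]_(N, m))
    (p : R -> R) (alpha : 'cV[R]_m) : R :=
  \sum_(i < N) p ((Phi *m alpha) i ord0).

Definition constraint_set (R : realType) (N m : nat) (Phi : 'M[R]_(N, m))
    (umin umax : R) : set 'cV[R]_m :=
  [set alpha | forall i : 'I_N, umin <= (Phi *m alpha) i ord0 <= umax].

Definition objective (R : realType) (N m r : nat) (Phi : 'M[R]_(N, m))
    (C : 'M[R]_(r, N)) (y : 'cV[R]_r) (p : R -> R) (lambda : R)
    (alpha : 'cV[R]_m) : R :=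
  2^-1 * enorm (C *m Phi *m alpha - y) ^+ 2 +
  lambda * total_penalty Phi p alpha.

(* Main.v *)
Require Import Defs.

Set Implicit Arguments.
Unset Strict Implicit.
Unset Printing Implicit Defensive.

Import Order.TTheory GRing.Theory Num.Theory.
Import numFieldNormedType.Exports.

Local Open Scope classical_set_scope.
Local Open Scope ring_scope.

(* Comparing [alpha lambda] with a feasible point gives
   [total_penalty (alpha lambda) <= K / lambda] with [K] independent of [lambda].
   Since [p''] is positive outside [[umin, umax]], [p] is positive there, so a
   small total penalty forces [alpha lambda] into the compact set of points
   violating the constraints by at most [1].  On the part of this compact set
   at distance at least [eps] from the feasible set, the total penalty has a
   positive minimum, which [K / lambda] eventually undershoots. *)

Lemma continuous_sumr (R : realType) (T : topologicalType) (n : nat)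
    (f : 'I_n -> T -> R) :
  (forall i, continuous (f i)) -> continuous (fun x => \sum_(i < n) f i x).
Proof.
by move=> cf; apply: continuous_big => // z; exact: add_continuous.
Qed.

Lemma continuous_mulmx_coord (R : realType) (N m : nat) (A : 'M[R]_(N, m))
    (i : 'I_N) :
  continuous (fun x : 'cV[R]_m => (A *m x) i ord0).
Proof.
under eq_fun do rewrite mxE.
apply: continuous_sumr => j x.
apply: (@continuous_comp _ _ _ (fun x : 'cV[R]_m => x j ord0) ( *%R (A i j))).
  exact: coord_continuous.
exact: mulrl_continuous.
Qed.

Lemma continuous_trmx (R : realType) (m n : nat) :
  continuous (@trmx R m n).
Proof.
move=> M s /nbhs_ballP[e e0 es]; apply/nbhs_ballP; exists e => //= L [_ ML].
by apply: es; split=> // i j; rewrite !mxE; exact: ML.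
Qed.

(** A product of segments is compact by [rV_compact], and continuous transposition carries this from
    rows to columns. *)
Lemma compact_cV_box (R : realType) (n : nat) (B : R) :
  compact [set v : 'cV[R]_n | forall i, v i ord0 \in `[- B, B]].
Proof.
rewrite [X in compact X](_ : _ = trmx @`
    [set v : 'rV[R]_n | forall i, `[- B, B]%classic (v ord0 i)]).
  apply: continuous_compact.
    by apply: continuous_subspaceT; exact: continuous_trmx.
  by apply: (@rV_compact R n (fun=> `[- B, B]%classic)) => i;
    exact: segment_compact.
apply/seteqP; split=> [v vB | _ [v vB <-] i /=]; last by rewrite mxE; exact: vB.
by exists v^T; rewrite ?trmxK//= => i; rewrite mxE; exact: vB.
Qed.

(** The topology on column vectors comes from the max norm, so continuity of the Euclidean distance
    is built up from the coordinates. It makes Euclidean balls open. *)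
Lemma continuous_enormB (R : realType) (n : nat) (b : 'cV[R]_n) :
  continuous (fun a : 'cV[R]_n => enorm (a - b)).
Proof.
move=> a; apply: (@continuous_comp _ _ _
  (fun a : 'cV[R]_n => \sum_(i < n) (a - b) i ord0 ^+ 2) Num.sqrt);
  last exact: sqrt_continuous.
apply: continuous_sumr => i {}a.
under eq_fun do rewrite !mxE.
apply: (@continuous_comp _ _ _ (fun x : 'cV[R]_n => x i ord0 - b i ord0)
  (fun t => t ^+ 2)); last exact: exprn_continuous.
apply: (@continuousB _ _ _ (fun x : 'cV[R]_n => x i ord0) (cst _)).
  exact: coord_continuous.
exact: cst_continuous.
Qed.

Lemma edist_set_ge0 (R : realType) (n : nat) (a : 'cV[R]_n) (S : set 'cV[R]_n) :
  S !=set0 -> 0 <= edist_set a S.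
Proof.
move=> [b Sb]; apply: lb_le_inf; first by exists (enorm (a - b)), b.
by move=> _ [c _ <-]; exact: sqrtr_ge0.
Qed.

Lemma edist_set_le (R : realType) (n : nat) (a b : 'cV[R]_n)
    (S : set 'cV[R]_n) :
  S b -> edist_set a S <= enorm (a - b).
Proof.
move=> Sb; apply: ge_inf; last by exists b.
by exists 0 => _ [c _ <-]; exact: sqrtr_ge0.
Qed.

(** Vanishing near [x] means vanishing around each point near [x] ([near_join]), so the first
    derivative is also zero near [x]. *)
Lemma near_eq0_derive1n2 (R : realType) (f : R -> R) (x : R) :
  (\forall t \near x, f t = 0) -> (f^`(2))%classic x = 0.
Proof.
move=> f0; rewrite derive1nS derive1n1 derive1E.
rewrite (@near_eq_derive _ _ _ _ (cst 0)) ?derive_cst//.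
have := near_join f0; apply: filterS => t ft.
by rewrite derive1E (@near_eq_derive _ _ _ _ (cst 0)) ?derive_cst.
Qed.

Section penalty.
Variables (R : realType) (umin umax : R) (p : R -> R).
Hypothesis hp : admissible_penalty umin umax p.

(* If [p u = 0] outside the interval, monotonicity makes [p] vanish between [u]
   and the interval, against [p'' > 0] there. *)
Lemma penalty_gt0 (u : R) : u \notin `[umin, umax] -> 0 < p u.
Proof.
move=> uI; rewrite lt_neqAle (penalty_ge0 hp) andbT eq_sym.
apply/eqP => pu0.
suff [v vI pv] : exists2 v, v \notin `[umin, umax] &
    \forall t \near v, p t = 0.
  by have := penalty_gt0_2 hp vI; rewrite near_eq0_derive1n2// ltxx.
move: uI; rewrite in_itv/= negb_and -!ltNge => /orP[uI|uI].
- have [uv vm] := midf_lt uI; exists ((u + umin) / 2).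
    by rewrite in_itv/= negb_and -ltNge vm.
  have : (u + umin) / 2 \in `]u, umin[ by rewrite in_itv/= uv.
  move/near_in_itvoo; apply: filterS => t; rewrite in_itv/= => /andP[ut tm].
  apply/le_anti/andP; split; last exact: penalty_ge0 hp _.
  by rewrite -pu0; apply: (penalty_decr hp); rewrite ?in_itv//= ltW.
- have [mv vu] := midf_lt uI; exists ((umax + u) / 2).
    by rewrite in_itv/= negb_and -!ltNge mv orbT.
  have : (umax + u) / 2 \in `]umax, u[ by rewrite in_itv/= mv.
  move/near_in_itvoo; apply: filterS => t; rewrite in_itv/= => /andP[mt tu].
  apply/le_anti/andP; split; last exact: penalty_ge0 hp _.
  by rewrite -pu0; apply: (penalty_incr hp); rewrite ?in_itv/= ?andbT// ltW.
Qed.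

(** By monotonicity, moving further out than one unit beyond an endpoint cannot bring [p] below its
    value at that unit distance, which is positive. *)
Lemma penalty_lt_bounded :
  exists2 c, 0 < c &
    forall u, p u < c -> umin - 1 <= u <= umax + 1.
Proof.
exists (Num.min (p (umin - 1)) (p (umax + 1))).
  rewrite lt_min !penalty_gt0// in_itv/= negb_and -!ltNge.
    by rewrite ltrDl ltr01 orbT.
  by rewrite gtrBl ltr01.
move=> u; rewrite lt_min => /andP[pl pr]; apply/andP; split; rewrite leNgt.
- apply/negP => h; move: pl; rewrite ltNge => /negP; apply.
  apply: (penalty_decr hp); rewrite ?in_itv/= ?ltrBlDr ?ltrDl ?ltr01//.
    by rewrite (lt_trans h)// gtrBl.
  exact: ltW.
- apply/negP => h; move: pr; rewrite ltNge => /negP; apply.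
  apply: (penalty_incr hp); rewrite ?in_itv/= ?andbT ?ltrDl ?ltr01//.
    by rewrite (lt_trans _ h)// ltrDl.
  exact: ltW.
Qed.

Variables (N m : nat) (Phi : 'M[R]_(N, m)).

Lemma penalty_le_total (a : 'cV[R]_m) (i : 'I_N) :
  p ((Phi *m a) i ord0) <= total_penalty Phi p a.
Proof.
rewrite /total_penalty (bigD1 i)//= lerDl.
by apply: sumr_ge0 => j _; exact: penalty_ge0 hp _.
Qed.

Lemma total_penalty_eq0 (a : 'cV[R]_m) :
  constraint_set Phi umin umax a -> total_penalty Phi p a = 0.
Proof.
by move=> aS; apply: big1 => i _; apply: (penalty_eq0 hp); exact: aS.
Qed.

Lemma total_penalty_gt0 (a : 'cV[R]_m) :
  ~ constraint_set Phi umin umax a -> 0 < total_penalty Phi p a.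
Proof.
move=> /existsNP[i /negP ai]; apply: lt_le_trans (penalty_le_total a i).
exact: penalty_gt0.
Qed.

Lemma continuous_total_penalty : continuous (total_penalty Phi p).
Proof.
apply: continuous_sumr => i a.
apply: (@continuous_comp _ _ _ (fun a => (Phi *m a) i ord0) p).
  exact: continuous_mulmx_coord.
apply: differentiable_continuous; apply/derivable1_diffP.
exact: penalty_derivable hp _.
Qed.

End penalty.

(* [Phi] is injective: coordinates are recovered as [a = Phi^T Phi a]. *)
Lemma compact_constraint_set (R : realType) (N m : nat) (Phi : 'M[R]_(N, m))
    (l h : R) :
  orthonormal_columns Phi -> compact (constraint_set Phi l h).
Proof.
move=> hPhi.
pose M := Num.max `|l| `|h|.
(* The inner sum bounds coordinate [j] of [Phi^T Phi a]; adding up these nonnegative bounds over [j]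
   gives one constant for all coordinates. *)
pose B := \sum_(j < m) \sum_(i < N) `|Phi i j| * M.
apply: (@subclosed_compact _ _ _ _ (@compact_cV_box R m B)).
  rewrite (_ : constraint_set _ _ _ = \bigcap_(i in setT)
      ((fun a : 'cV[R]_m => (Phi *m a) i ord0) @^-1` `[l, h]%classic)).
    apply: closed_bigI => i _; apply: preimage_closed; last exact: itv_closed.
    by move=> a _; exact: continuous_mulmx_coord.
  apply/seteqP; split=> a aS i /=; first by move=> _; rewrite in_itv/=; exact: aS.
  by have := aS i Logic.I; rewrite /= in_itv.
move=> a aS j; rewrite in_itv/= -ler_norml.
have -> : a j ord0 = \sum_(i < N) Phi i j * (Phi *m a) i ord0.
  have PP : Phi^T *m Phi = 1%:M.
    apply/matrixP => k k'; rewrite !mxE -hPhi.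
    by apply: eq_bigr => i _; rewrite mxE.
  rewrite -[in LHS](mul1mx a) -PP -mulmxA mxE.
  by apply: eq_bigr => i _; rewrite [Phi^T _ _]mxE.
apply: le_trans (ler_norm_sum _ _ _) _.
rewrite /B (bigD1 j)//= -[leLHS]addr0; apply: lerD.
  apply: ler_sum => i _; rewrite normrM ler_wpM2l//.
  have /andP[la ah] := aS i.
  rewrite /M ler_norml; apply/andP; split.
    by rewrite lerNl le_max -normrN (le_trans _ (ler_norm _))// lerN2.
  by rewrite le_max (le_trans ah (ler_norm _)) orbT.
apply: sumr_ge0 => k _; apply: sumr_ge0 => i _.
by rewrite mulr_ge0// /M le_max normr_ge0.
Qed.

(** The threshold [d] depends on [e] but not on the point, so it serves for every [alpha lambda].
    Asking for a close feasible point, not a small infimum, lets the good points form a union of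
    open balls. *)
Lemma total_penalty_lt_near (R : realType) (N m : nat)
    (umin umax : R) (Phi : 'M[R]_(N, m)) (p : R -> R) (e : R) :
  orthonormal_columns Phi -> admissible_penalty umin umax p ->
  0 < e ->
  exists2 d, 0 < d & forall a, total_penalty Phi p a < d ->
    exists2 b, constraint_set Phi umin umax b & enorm (a - b) < e.
Proof.
move=> hPhi hp e0.
set S := constraint_set Phi umin umax.
pose U := \bigcup_(b in S) [set a | enorm (a - b) < e].
have Uo : open U.
  apply: bigcup_open => b _.
  apply: (@open_comp _ _ (fun a : 'cV[R]_m => enorm (a - b)) [set t | t < e]).
    by move=> a _; exact: continuous_enormB.
  exact: open_lt.
pose K := constraint_set Phi (umin - 1) (umax + 1) `&` ~` U.
have Kc : compact K.
  by apply: compact_closedI; [exact: compact_constraint_set | exact: open_closedC].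
have [c c0 pc] := penalty_lt_bounded hp.
have inB a : total_penalty Phi p a < c ->
    constraint_set Phi (umin - 1) (umax + 1) a.
  by move=> ac i; apply: pc; apply: le_lt_trans ac; exact: (penalty_le_total hp).
(* Without points in [K] there is no minimum to take, but then [c] alone is a valid threshold. *)
have [K0|/set0P KN0] := eqVneq K set0.
  exists c => // a ac; have aB := inB _ ac.
  have [b Sb ab] : U a by apply: contrapT => aU; have : K a by []; rewrite K0.
  by exists b.
have [a0 + a0min] := compact_EVT_min KN0 Kc
  (continuous_subspaceT (continuous_total_penalty hp (Phi := Phi))).
rewrite inE => -[_ a0U].
(* A feasible [a0] would lie in [U], being the centre of one of its balls. *)
have P0 : 0 < total_penalty Phi p a0.
  apply: (total_penalty_gt0 hp) => a0S; apply: a0U; exists a0 => //=.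
  by rewrite subrr /enorm big1 ?sqrtr0// => i _; rewrite mxE expr0n.
(* Below [c] the point lies in the enlarged constraint set; being also below the minimum over [K],
   it must lie in [U]. *)
exists (Num.min c (total_penalty Phi p a0)); first by rewrite lt_min c0.
move=> a; rewrite lt_min => /andP[ac aP].
have [b Sb ab] : U a; last by exists b.
apply: contrapT => aU; move: aP; apply/negP; rewrite -leNgt.
by apply: a0min; rewrite inE; split=> //; exact: inB.
Qed.

Theorem theorem1 (R : realType) (N m r : nat)
    (hN : (0 < N)%N) (hm : (0 < m)%N) (hr : (0 < r)%N)
    (umin umax : R) (hminmax : umin <= umax)
    (Phi : 'M[R]_(N, m)) (hPhi : orthonormal_columns Phi)
    (C : 'M[R]_(r, N)) (hC : selection_matrix C)
    (u : 'cV[R]_N) (hu : forall i : 'I_N, umin <= u i ord0 <= umax)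
    (y : 'cV[R]_r) (hy : y = C *m u)
    (p : R -> R) (hp : admissible_penalty umin umax p)
    (hS : constraint_set Phi umin umax !=set0)
    (alpha : R -> 'cV[R]_m)
    (halpha : forall lambda : R, 0 < lambda ->
       forall beta : 'cV[R]_m,
         objective Phi C y p lambda (alpha lambda) <=
         objective Phi C y p lambda beta) :
  edist_set (alpha lambda) (constraint_set Phi umin umax)
    @[lambda --> +oo] --> (0 : R).
Proof.
have [b0 Sb0] := hS.
(* This is the objective at [b0] for every [lambda], since the penalty vanishes there. *)
pose K := 2^-1 * enorm (C *m Phi *m b0 - y) ^+ 2.
have PK lambda : 0 < lambda ->
    lambda * total_penalty Phi p (alpha lambda) <= K.
  move=> l0; have := halpha _ l0 b0.
  rewrite /objective (total_penalty_eq0 hp Sb0) mulr0 addr0.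
  by apply: le_trans; rewrite lerDr mulr_ge0 ?invr_ge0 ?sqr_ge0.
apply/cvgrPdist_lt => e e0.
have [d d0 dP] := total_penalty_lt_near hPhi hp e0.
near=> lambda.
have l0 : 0 < lambda by near: lambda; exact: nbhs_pinfty_gt.
rewrite sub0r normrN ger0_norm; last exact: edist_set_ge0.
have [b Sb ab] : exists2 b, constraint_set Phi umin umax b &
    enorm (alpha lambda - b) < e.
  apply: dP; rewrite -(ltr_pM2l l0); apply: le_lt_trans (PK _ l0) _.
  (* It remains to have [K / d < lambda], true for all large [lambda]. *)
  rewrite -ltr_pdivrMr//.
  by near: lambda; apply: nbhs_pinfty_gt; exact: num_real.
by apply: le_lt_trans ab; exact: edist_set_le.
Unshelve. all: by end_near.
Qed.
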